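(* Let $q$ be a non-negative integer. A cograph $G$ has a $q$-colourable vertex feedback set if and only if $G$ is $\{K_{q+3},\overline{(q+2)K_2}\}$-free, i.e. $G$ contains neither $K_{q+3}$ nor $\overline{(q+2)K_2}$ as an induced subgraph.
   Context: All graphs are finite and simple. $nG$ is the disjoint union of $n$ copies of $G$ and $\overline{G}$ is the complement, so $\overline{sK_2}$ is the complete $s$-partite graph with two vertices in each part. A cograph is a graph with no induced path $P_4$ on four vertices; equivalently, a graph obtainable from $K_1$ by repeatedly applying disjoint union and complement. A graph $G$ has a $q$-colourable vertex feedback set if $V(G)$ can be partitioned into one set inducing a forest and $q$ independent sets (parts may be empty). *)

(* Defs.v *)
From mathcomp Require Import all_boot.
Set Implicit Arguments.
Unset Strict Implicit.
Unset Printing Implicit Defensive.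

(* The vertex set of a graph may be empty. *)

Record sgraph := SGraph {
  vertex :> finType;
  adj : rel vertex;
  adj_sym : symmetric adj;
  adj_irrefl : irreflexive adj
}.

Section Constructions.

Fact complete_sym n : symmetric (fun i j : 'I_n => i != j).
Proof. by move=> i j; rewrite eq_sym. Qed.

Fact complete_irrefl n : irreflexive (fun i j : 'I_n => i != j).
Proof. by move=> i; rewrite eqxx. Qed.

Definition complete_graph n := SGraph (@complete_sym n) (@complete_irrefl n).

Definition path_adj n : rel 'I_n := fun i j => (i.+1 == j) || (j.+1 == i).

Fact path_sym n : symmetric (@path_adj n).
Proof. by move=> i j; rewrite /path_adj orbC. Qed.

Fact path_irrefl n : irreflexive (@path_adj n).
Proof. by move=> i; rewrite /path_adj orbb gtn_eqF. Qed.

(* [n] is the number of vertices. *)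
Definition path_graph n := SGraph (@path_sym n) (@path_irrefl n).

Variable G : sgraph.

Definition compl_adj : rel G := fun x y => (x != y) && ~~ adj x y.

Fact compl_sym : symmetric compl_adj.
Proof. by move=> x y; rewrite /compl_adj eq_sym adj_sym. Qed.

Fact compl_irrefl : irreflexive compl_adj.
Proof. by move=> x; rewrite /compl_adj eqxx. Qed.

Definition compl_graph := SGraph compl_sym compl_irrefl.

Definition copies_adj n : rel ('I_n * G) :=
  fun u v => (u.1 == v.1) && adj u.2 v.2.

Fact copies_sym n : symmetric (@copies_adj n).
Proof. by move=> u v; rewrite /copies_adj eq_sym adj_sym. Qed.

Fact copies_irrefl n : irreflexive (@copies_adj n).
Proof. by move=> u; rewrite /copies_adj adj_irrefl andbF. Qed.

Definition copies n := SGraph (@copies_sym n) (@copies_irrefl n).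

Variable S : {set G}.

Definition induced_adj : rel {x : G | x \in S} :=
  fun u v => adj (val u) (val v).

Fact induced_sym : symmetric induced_adj.
Proof. by move=> u v; rewrite /induced_adj adj_sym. Qed.

Fact induced_irrefl : irreflexive induced_adj.
Proof. by move=> u; rewrite /induced_adj adj_irrefl. Qed.

Definition induced := SGraph induced_sym induced_irrefl.

End Constructions.

Definition isomorphic (G H : sgraph) : Prop :=
  exists2 f : G -> H, bijective f & forall x y, adj (f x) (f y) = adj x y.

Definition contains_induced (G H : sgraph) : Prop :=
  exists S : {set G}, isomorphic (induced S) H.

Definition free (G H : sgraph) : Prop := ~ contains_induced G H.

Definition cograph (G : sgraph) : Prop := free G (path_graph 4).

(* The lower bound on the length matters: for the library, [:: x; y] is a
   cycle as soon as x and y are adjacent. *)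
Definition forest (G : sgraph) : Prop :=
  forall c : seq G, 2 < size c -> ~ ucycle (@adj G) c.

Definition independent (G : sgraph) (I : {set G}) : Prop :=
  {in I &, forall x y, ~~ adj x y}.

Definition has_colourable_fvs (q : nat) (G : sgraph) : Prop :=
  exists (F : {set G}) (I : 'I_q -> {set G}),
    [/\ F :|: \bigcup_i I i = [set: G],
        forall i, [disjoint F & I i],
        forall i j, i != j -> [disjoint I i & I j],
        forest (induced F)
      & forall i, independent (I i)].

(* Main.v *)
(* In a cograph S with at least two vertices, either S or its complement is
   disconnected, so S is built from single vertices by disjoint unions and
   joins.  Along this construction we maintain a clique and a proper colouring
   of the same size k, together with one of three certificates: an induced
   complement of kK_2, a (k-2)-colourable feedback vertex set, or k = 1 and S is
   a single vertex.  In a join of A and B, of clique numbers a and b, two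
   octahedra add up; if A has an (a-2)-colourable feedback vertex set then
   colouring B with b new colours gives one for the join with a+b-2 colours; and
   if A is a single vertex v, then v and one colour class of B form a star.
   For the theorem, k <= q+1 allows one colour class to serve as the forest, and
   k = q+2 leaves only the second certificate. *)

Require Import Defs.
From mathcomp Require Import all_boot zify.
Set Implicit Arguments.
Unset Strict Implicit.
Unset Printing Implicit Defensive.

(** * Disconnectedness of a [P4]-free graph or of its complement *)

Section Splitting.
Variable T : finType.
Implicit Types (e : rel T) (A H S : {set T}).

(** Ranging over all walks of length three is harmless: if two of the vertices coincide, symmetry of
    [e] already supplies one of the three chords. *)
Definition P4_free e := forall a b c d,
  e a b -> e b c -> e c d -> [|| e a c, e b d | e a d].

Definition compl_rel e : rel T := fun x y => (x != y) && ~~ e x y.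

(** Disconnectedness of the subgraph on [S], phrased through a union [A] of components so that no
    paths have to be built. *)
Definition splits e S := exists A,
  [/\ A \subset S, A != set0, A != S & {in A & S :\: A, forall x y, ~~ e x y}].

Lemma compl_rel_sym e : symmetric e -> symmetric (compl_rel e).
Proof. by move=> es x y; rewrite /compl_rel eq_sym es. Qed.

Lemma P4_free_compl e : symmetric e -> P4_free e -> P4_free (compl_rel e).
Proof.
move=> es P4 a b c d ab bc cd.
have [ac|ac] := eqVneq a c; first by rewrite ac cd !orbT.
have [bd|bd] := eqVneq b d; first by rewrite -bd ab !orbT.
have [ad|ad] := eqVneq a d; first by rewrite -ad (compl_rel_sym es b a) ab !orbT.
move: ab bc cd; rewrite /compl_rel ac bd ad /= => /andP[_ nab] /andP[_ nbc] /andP[_ ncd].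
apply: contraNT nab; rewrite !negb_or !negbK => /and3P[eac ebd ead].
(* [P4] is self-complementary: a chordless [a b c d] in the complement is the path [c a d b] in
   [e]. *)
have := P4 c a d b; rewrite (es c a) (es d b) (es c b) (negPf ncd) (negPf nbc) orbF.
exact.
Qed.

Lemma splits_setD e A S : symmetric e -> A \subset S -> A != set0 -> A != S ->
  {in A & S :\: A, forall x y, ~~ e x y} ->
  [/\ S :\: A \subset S, S :\: A != set0, S :\: A != S &
    {in S :\: A & S :\: (S :\: A), forall x y, ~~ e x y}].
Proof.
move=> es AS A0 AnS nA; split.
- exact: subsetDl.
- by rewrite setD_eq0; apply: contra AnS => SA; rewrite eqEsubset AS.
- apply: contra A0 => /eqP/setDidPl; rewrite disjoint_sym => /disjoint_setI0.
  by rewrite (setIidPl AS) => ->.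
- by move=> x y xA; rewrite setDDr setDv set0U (setIidPr AS) => yA; rewrite es nA.
Qed.

(** If [v] sees all of [H], it is isolated in the complement. Otherwise take the side [A0]
    containing a non-neighbour of [v]: either the non-neighbours of [v] in [A0] form a union of
    components, or [v] has no neighbour on the other side. *)
Lemma splits_add e v H : symmetric e -> P4_free e -> v \notin H ->
  splits e H -> splits e (v |: H) \/ splits (compl_rel e) (v |: H).
Proof.
move=> es P4 vH [A0 [A0H A00 A0nH nA0]].
have [/forall_inP vall | ] := boolP [forall w in H, e v w].
  right; exists [set v]; split.
  - by rewrite sub1set setU11.
  - by apply/set0Pn; exists v; rewrite set11.
  - apply/eqP => vE; case/set0Pn: A00 => x xA; have xH := subsetP A0H _ xA.
    have: x \in [set v] by rewrite vE inE xH orbT.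
    by rewrite inE => /eqP xv; rewrite -xv xH in vH.
  - move=> x y; rewrite !inE => /eqP-> /andP[/negPf-> /= yH].
    by rewrite /compl_rel vall // andbF.
rewrite negb_forall_in => /exists_inP[w wH nvw]; left.
wlog wA : A0 A0H A00 A0nH nA0 / w \in A0.
  move=> main; have [wA|wA] := boolP (w \in A0); first exact: main wA.
  have [? ? ? ?] := splits_setD es A0H A00 A0nH nA0.
  by apply: (main (H :\: A0)) => //; rewrite inE wA.
have vA : v \notin A0 by apply: contra vH; apply: (subsetP A0H).
pose Y := [set y in A0 | ~~ e v y].
have [/forall_inP noYX | ] := boolP [forall y in Y, [forall x in A0 :\: Y, ~~ e y x]].
  exists Y; split.
  - by apply/subsetP => y; rewrite !inE => /andP[/(subsetP A0H)-> _]; rewrite orbT.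
  - by apply/set0Pn; exists w; rewrite inE wA.
  - by apply/eqP => YE; have := setU11 v H; rewrite -YE inE (negPf vA).
  - move=> y x yY; rewrite in_setD => /andP[xY /setU1P[->|xH]].
      by move: yY; rewrite inE es => /andP[].
    have [xA|xA] := boolP (x \in A0).
      by have /forall_inP := noYX y yY; apply; rewrite in_setD xY.
    by apply: nA0; [move: yY; rewrite inE => /andP[] | rewrite inE xA].
rewrite negb_forall_in => /exists_inP[y]; rewrite inE => /andP[yA nvy].
rewrite negb_forall_in => /exists_inP[x]; rewrite !inE => /andP[xY xA].
rewrite xA negbK /= in xY; rewrite negbK => yx.
(* Here [v], [x], [y] is an induced path with [x] and [y] in [A0]. *)
exists (H :\: A0); split.
- by apply/subsetP => z; rewrite !inE => /andP[_ ->]; rewrite orbT.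
- by have [] := splits_setD es A0H A00 A0nH nA0.
- by apply/eqP => E; have := setU11 v H; rewrite -E inE (negPf vH) andbF.
- move=> z u zB; rewrite in_setD => /andP[uB /setU1P[->|uH]]; last first.
    rewrite es nA0 //; move: uB; rewrite inE uH andbT negbK //.
  (* A neighbour [z] of [v] outside [A0] would extend that path to the induced path [z v x y]. *)
  apply/negP => zv; have := P4 z v x y zv xY; rewrite (es x y) => /(_ yx).
  by rewrite (negPf nvy) !(es z) (negPf (nA0 _ _ xA zB)) (negPf (nA0 _ _ yA zB)).
Qed.

Lemma splits_compl2 e S : splits (compl_rel (compl_rel e)) S -> irreflexive e -> splits e S.
Proof.
case=> A [AS A0 AnS nA] ei; exists A; split=> // x y xA yA.
have := nA x y xA yA; rewrite /compl_rel.
by case: eqVneq => [->|] /=; rewrite ?ei ?negbK.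
Qed.

(** Delete one vertex and induct. The hypotheses are stable under complement, so [splits_add] puts
    the vertex back whichever of the two graphs splits. *)
Lemma P4_free_splits e S : symmetric e -> irreflexive e -> P4_free e ->
  1 < #|S| -> splits e S \/ splits (compl_rel e) S.
Proof.
move=> es ei P4; have [n] := ubnP #|S|; elim: n S => // n IHn S Sn S1.
have /card_gt0P[v vS] : 0 < #|S| by exact: ltnW.
have [H vH SE] : exists2 H : {set T}, v \notin H & S = v |: H.
  by exists (S :\ v); rewrite ?setD1K // !inE eqxx.
rewrite SE in Sn S1 *; rewrite cardsU1 vH in Sn S1.
have [H1|H1] := leqP #|H| 1.
  have [w HE] : exists w, H = [set w] by apply/cards1P; rewrite eqn_leq H1.
  have nvw : v != w by apply: contra vH => /eqP->; rewrite HE set11.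
  have vnE : [set v] != v |: H.
    apply/eqP => E; have : w \in [set v] by rewrite E HE !inE eqxx orbT.
    by rewrite inE eq_sym (negPf nvw).
  have v0 : [set v] != set0 by apply/set0Pn; exists v; rewrite set11.
  have [evw|evw] := boolP (e v w); [right|left]; exists [set v]; split=> //;
    rewrite ?sub1set ?setU11 // HE => x y; rewrite !inE => /eqP-> /andP[/negPf->] /= /eqP-> //.
  by rewrite /compl_rel evw andbF.
have Hn : #|H| < n by [].
case: (IHn H Hn H1) => spl; first exact: splits_add.
case: (splits_add (compl_rel_sym es) (P4_free_compl es P4) vH spl) => spl'.
  by right.
by left; apply: splits_compl2.
Qed.

End Splitting.

(** * Induction on cographs by disjoint unions and joins *)

Section Cographs.
Variable G : sgraph.
Implicit Types (A B S : {set G}) (c : G -> nat).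

Local Notation "x -- y" := (@adj G x y) (at level 30).

(** A split of the graph yields a disjoint union and a split of the complement a join. The join case
    records that both sides are nonempty, because joining a single vertex to the empty set would not
    save a colour. *)
Lemma P4_free_ind (P : {set G} -> Prop) : P4_free (@adj G) ->
  P set0 -> (forall x, P [set x]) ->
  (forall A B, [disjoint A & B] -> {in A & B, forall x y, ~~ x -- y} ->
     P A -> P B -> P (A :|: B)) ->
  (forall A B, B != set0 -> A != set0 -> {in A & B, forall x y, x -- y} ->
     P A -> P B -> P (A :|: B)) ->
  forall S, P S.
Proof.
move=> P4 P0 P1 PU PJ S; have [n] := ubnP #|S|; elim: n S => // n IHn S Sn.
have [S1|] := ltnP 1 #|S|; last first.
  have [->//|S0 S1] := eqVneq S set0.
  have /cards1P[x -> //] : #|S| == 1 by rewrite eqn_leq S1 card_gt0.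
have spl := P4_free_splits (@adj_sym G) (@adj_irrefl G) P4 S1.
have red A : A \subset S -> A != set0 -> A != S ->
    [/\ P A, P (S :\: A), S :\: A != set0 & S = A :|: (S :\: A)].
  move=> AS A0 AnS; have AltS : A \proper S by rewrite properEneq AnS.
  have SE : S = A :|: (S :\: A) by rewrite setDE setUIr setUCr setIT (setUidPr AS).
  have D0 : S :\: A != set0 by rewrite setD_eq0; case/andP: AltS.
  have := proper_card AltS; have := cardsD S A; rewrite (setIidPr AS).
  rewrite -card_gt0 in A0; split=> //; apply: IHn; lia.
case: spl => -[A [AS A0 AnS nA]]; have [PA PD D0 ->] := red A AS A0 AnS.
  by apply: PU => //; rewrite disjoint_sym disjoints_subset subsetDr.
apply: PJ => // x y xA yA; have := nA x y xA yA.
rewrite /compl_rel; have -> /= : x != y; last by rewrite negbK.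
by apply: contraTneq yA => <-; rewrite inE xA.
Qed.

(** * Acyclic vertex sets *)

Definition acyclic S := forall s : seq G,
  2 < size s -> {subset s <= S} -> ~ ucycle (@adj G) s.

Lemma independent_acyclic S : independent S -> acyclic S.
Proof.
move=> indS [|x [|y s]] //= _ sS /andP[/andP[xy _] _].
have xS : x \in S by rewrite sS ?inE ?eqxx.
have yS : y \in S by rewrite sS ?inE ?eqxx ?orbT.
by have := indS x y xS yS; rewrite xy.
Qed.

Lemma star_acyclic v S : independent S -> acyclic (v |: S).
Proof.
move=> indS [|x [|y [|z s]]] //= _ sS /andP[].
rewrite /= rcons_path => /and4P[xy yz _ lx]; rewrite !inE !negb_or => /and4P[].
move=> /and3P[nxy nxz xs] /andP[nyz ys] zs us.
have inS u : u \in [:: x, y, z & s] -> u != v -> u \in S.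
  by move=> /sS; rewrite !inE => /orP[/eqP->|//]; rewrite eqxx.
have no u w : u \in [:: x, y, z & s] -> w \in [:: x, y, z & s] ->
    u -- w -> u != v -> w != v -> False.
  by move=> us' ws uw uv wv; have := indS _ _ (inS u us' uv) (inS w ws wv); rewrite uw.
(* A cycle visits [v] at most once, so one of the edges [y z], [x y] and the closing edge back to
   [x] avoids [v] and lies inside [S]. *)
have [xv|xv] := eqVneq x v; first by apply: (no y z) => //; rewrite ?inE ?eqxx ?orbT -?xv // eq_sym.
have [yv|yv] := eqVneq y v; last by apply: (no x y) => //; rewrite ?inE ?eqxx ?orbT.
have lzs := mem_last z s.
apply: (no (last z s) x) => //; rewrite ?inE ?eqxx ?orbT //.
  by move: lzs; rewrite inE => /orP[->|->]; rewrite !orbT.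
by rewrite -yv; apply: contraTneq lzs => ->; rewrite inE negb_or nyz.
Qed.

(** A walk starting on one side cannot cross to the other, so every cycle lies in [A] or in [B]. *)
Lemma acyclicU A B : {in A & B, forall x y, ~~ x -- y} ->
  acyclic A -> acyclic B -> acyclic (A :|: B).
Proof.
have stay (C D : {set G}) x s : {in C & D, forall x y, ~~ x -- y} ->
    x \in C -> {subset s <= C :|: D} -> path (@adj G) x s -> {subset x :: s <= C}.
  move=> nCD; elim: s x => [|y s IHs] x xC sCD /=.
    by move=> _ z; rewrite inE => /eqP->.
  case/andP=> xy ys; have yC : y \in C.
    have := sCD y (mem_head _ _); rewrite inE => /orP[//|yD].
    by have := nCD _ _ xC yD; rewrite xy.
  move=> z; rewrite inE => /orP[/eqP->//|]; apply: IHs => // u us.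
  by apply: sCD; rewrite inE us orbT.
move=> nAB aA aB [//|x s] s2 sAB cyc.
have := sAB x (mem_head _ _); have /andP[] := cyc => /=; rewrite rcons_path => /andP[xs _] _.
have sAB' : {subset s <= A :|: B} by move=> y ys; apply: sAB; rewrite inE ys orbT.
rewrite inE => /orP[xA|xB]; first exact: (aA _ s2 (stay A B x s nAB xA sAB' xs) cyc).
apply: (aB _ s2 (stay B A x s _ xB _ xs) cyc); last by rewrite setUC.
by move=> y z yB zA; rewrite adj_sym nAB.
Qed.

(** * Colourings, cliques and octahedra inside a vertex set *)

Definition colouring k S c :=
  {in S, forall x, c x < k} /\ {in S &, forall x y, x -- y -> c x != c y}.

(* Colour 0 is the forest, colours 1, ..., q are the independent sets. *)
Definition fvs_colouring q S c :=
  [/\ {in S, forall x, c x <= q},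
      {in S &, forall x y, x -- y -> c x = c y -> c x = 0} &
      acyclic [set x in S | c x == 0]].

Definition clique k S := exists K : {set G},
  [/\ K \subset S, #|K| = k & {in K &, forall x y, x != y -> x -- y}].

(** [f i] lists the [i]-th pair of antipodal vertices. Vertices of different pairs are adjacent,
    hence distinct, so injectivity is only asked within a pair. *)
Definition octahedron k S := exists f : 'I_k -> 'I_2 -> G,
  [/\ forall i b, f i b \in S, forall i, injective (f i) &
      forall i j b d, f i b -- f j d = (i != j)].

Lemma clique_sub k A B : A \subset B -> clique k A -> clique k B.
Proof. by move=> AB [K [KA ? ?]]; exists K; split=> //; apply: subset_trans AB. Qed.

Lemma octahedron_sub k A B : A \subset B -> octahedron k A -> octahedron k B.
Proof. by move=> AB [f [fA ? ?]]; exists f; split=> // i b; apply: (subsetP AB). Qed.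

Lemma colouring_leq k l S c : k <= l -> colouring k S c -> colouring l S c.
Proof. by move=> kl [ck cp]; split=> // x /ck /leq_trans; apply. Qed.

Lemma colouring_fvs q S c : colouring q.+1 S c -> fvs_colouring q S c.
Proof.
case=> ck cp; split=> // [x y xS yS xy cxy|].
  by have := cp x y xS yS xy; rewrite cxy eqxx.
apply: independent_acyclic => x y; rewrite !inE => /andP[xS /eqP cx] /andP[yS /eqP cy].
by apply/negP => /(cp x y xS yS); rewrite cx cy.
Qed.

Lemma fvs_colouring_leq q r S c : q <= r -> fvs_colouring q S c -> fvs_colouring r S c.
Proof. by move=> qr [ck cp ca]; split=> // x /ck /leq_trans; apply. Qed.

(** * Colourings of disjoint unions *)

Section Sum.
Variables A B : {set G}.
Hypotheses (dAB : [disjoint A & B]) (nAB : {in A & B, forall x y, ~~ x -- y}).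

Lemma notinA x : x \in B -> (x \in A) = false.
Proof. by move=> xB; apply: contraTF dAB => xA; apply/pred0Pn; exists x; rewrite /= xA. Qed.

Lemma colouring_sum k c d : colouring k A c -> colouring k B d ->
  colouring k (A :|: B) (fun x => if x \in A then c x else d x).
Proof.
move=> [ck cp] [dk dp]; split=> [x|x y]; rewrite !inE.
  by case: ifP => [/ck//|_ /= /dk].
case: ifP => xA /= xB; case: ifP => yA /= yB xy; [exact: cp| | |exact: dp].
  by have := nAB xA yB; rewrite xy.
by have := nAB yA xB; rewrite adj_sym xy.
Qed.

Lemma fvs_colouring_sum q c d : fvs_colouring q A c -> fvs_colouring q B d ->
  fvs_colouring q (A :|: B) (fun x => if x \in A then c x else d x).
Proof.
move=> [ck cp ca] [dk dp da]; split=> [x|x y|]; rewrite ?inE.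
- by case: ifP => [/ck//|_ /= /dk].
- case: ifP => xA /= xB; case: ifP => yA /= yB xy; [exact: cp| | |exact: dp].
    by have := nAB xA yB; rewrite xy.
  by have := nAB yA xB; rewrite adj_sym xy.
- suff -> : [set x in A :|: B | (if x \in A then c x else d x) == 0] =
      [set x in A | c x == 0] :|: [set x in B | d x == 0].
    by apply: acyclicU => // x y; rewrite !inE => /andP[xA _] /andP[yB _]; apply: nAB.
  by apply/setP => x; rewrite !inE; have [xB|xB] := boolP (x \in B);
    rewrite ?(notinA xB) ?orbF //=; case: (x \in A).
Qed.

End Sum.

(** * Colourings, cliques and octahedra in joins *)

Section Join.
Variables A B : {set G}.

Lemma colouring_join a b c d : colouring a A c -> colouring b B d ->
  colouring (a + b) (A :|: B) (fun x => if x \in A then c x else a + d x).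
Proof.
move=> [ck cp] [dk dp]; split=> [x|x y]; rewrite !inE.
  by case: ifP => [/ck|_ /= /dk]; lia.
case: ifP => xA /= xB; case: ifP => yA /= yB xy; first exact: cp.
- by have := ck x xA; lia.
- by have := ck y yA; lia.
- by have := dp x y xB yB xy; lia.
Qed.

(** [A] occupies the colours [0] to [q], so shifting [B] by [q.+1] keeps its colours apart from
    those of [A] and leaves the forest class unchanged. *)
Lemma fvs_colouring_join q b c d : fvs_colouring q A c -> colouring b B d ->
  fvs_colouring (q + b) (A :|: B) (fun x => if x \in A then c x else q.+1 + d x).
Proof.
move=> [ck cp ca] [dk dp]; split=> [x|x y|]; rewrite ?inE.
- by case: ifP => [/ck|_ /= /dk]; lia.
- case: ifP => xA /= xB; case: ifP => yA /= yB xy; first exact: cp.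
  + by have := ck x xA; lia.
  + by have := ck y yA; lia.
  + by have := dp x y xB yB xy; lia.
- suff -> : [set x in A :|: B | (if x \in A then c x else q.+1 + d x) == 0] =
      [set x in A | c x == 0] by [].
  by apply/setP => x; rewrite !inE; case: ifP; rewrite ?andbF.
Qed.

Hypothesis jAB : {in A & B, forall x y, x -- y}.

Lemma join_notin x : x \in B -> (x \in A) = false.
Proof. by move=> xB; apply/negP => xA; have := jAB xA xB; rewrite adj_irrefl. Qed.

Lemma clique_join a b : clique a A -> clique b B -> clique (a + b) (A :|: B).
Proof.
move=> [K [KA Ka Kc]] [L [LB Lb Lc]]; exists (K :|: L); split.
- exact: setUSS.
- rewrite cardsU Ka Lb (_ : K :&: L = set0) ?cards0 ?subn0 //.
  apply/setP => x; rewrite !inE; apply/negP => /andP[/(subsetP KA) xA /(subsetP LB) xB].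
  by rewrite (join_notin xB) in xA.
- move=> x y; rewrite !inE => /orP[xK|xL] /orP[yK|yL] xy; [exact: Kc| | |exact: Lc].
    by apply: jAB; [apply: (subsetP KA)|apply: (subsetP LB)].
  by rewrite adj_sym; apply: jAB; [apply: (subsetP KA)|apply: (subsetP LB)].
Qed.

Lemma octahedron_join a b : octahedron a A -> octahedron b B ->
  octahedron (a + b) (A :|: B).
Proof.
move=> [f [fA fi fe]] [g [gB gi ge]].
exists (fun i => match split i with inl j => f j | inr j => g j end); split.
- by move=> i t; rewrite inE; case: (split i) => j; rewrite ?fA ?gB ?orbT.
- by move=> i; case: (split i).
- move=> i j t u; rewrite -(can_eq (@splitK a b)); case: (split i) => i'; case: (split j) => j'.
  + by rewrite fe.
  + by rewrite jAB.
  + by rewrite adj_sym jAB.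
  + by rewrite ge.
Qed.

End Join.

(** Giving [v] colour 0 turns that independent class into a star, which is still a forest. *)
Lemma fvs_colouring_cone v S q c : {in S, forall x, v -- x} ->
  colouring q.+1 S c -> fvs_colouring q (v |: S) (fun x => if x == v then 0 else c x).
Proof.
move=> vS [ck cp]; split=> [x|x y|]; rewrite ?inE.
- by case: eqVneq => //= _ /ck.
- case: eqVneq => //= _ xS; case: eqVneq => //= _ yS xy cxy.
  by have := cp x y xS yS xy; rewrite cxy eqxx.
- have vnS : v \in S = false by apply/negP => /vS; rewrite adj_irrefl.
  suff -> : [set x in v |: S | (if x == v then 0 else c x) == 0] =
      v |: [set x in S | c x == 0].
    apply: star_acyclic => x y; rewrite !inE => /andP[xS /eqP cx] /andP[yS /eqP cy].
    by apply/negP => /(cp x y xS yS); rewrite cx cy.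
  by apply/setP => x; rewrite !inE; case: eqVneq.
Qed.

(** * Certificates along the construction of a cograph *)

Definition certified S := exists k, [/\ clique k S, exists c, colouring k S c &
  [\/ octahedron k S,
      exists2 q, k = q.+2 & exists c, fvs_colouring q S c |
      k = 1 /\ exists v, S = [set v]]].

(** The larger clique number [a] is that of the union, and a certificate of [A] must be extended
    over [B]. An octahedron in [A] persists; the other two cases depend on [B]. *)
Lemma certified_sum A B : [disjoint A & B] -> {in A & B, forall x y, ~~ x -- y} ->
  certified A -> certified B -> certified (A :|: B).
Proof.
move=> dAB nAB [a [Ka [c ca] cA]] [b [Kb [d db] cB]].
wlog ba : A B a b c d dAB nAB Ka ca cA Kb db cB / b <= a.
  move=> main; have [ba|ab] := leqP b a; first exact: (main A B a b c d).
  rewrite setUC; apply: (main B A b a d c) => //; [by rewrite disjoint_sym| |exact: ltnW].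
  by move=> x y xB yA; rewrite adj_sym nAB.
exists a; split; first exact: clique_sub (subsetUl _ _) Ka.
  by eexists; apply: (colouring_sum nAB ca (colouring_leq ba db)).
have octB : octahedron b B -> a = b -> octahedron a (A :|: B).
  by move=> oB ->; apply: octahedron_sub oB; apply: subsetUr.
case: cA => [oA|[q aE [c' c'q]]|[aE [v AE]]].
- by constructor 1; apply: octahedron_sub oA; apply: subsetUl.
(* If [b < a = q.+2], then [q.+1] colours suffice for [B] and one class can join the forest. If
   [b = a], the certificate of [B] decides. *)
- have [bE|bE] := eqVneq a b; last first.
    have bq : b <= q.+1 by lia.
    constructor 2; exists q => //; eexists.
    exact: (fvs_colouring_sum dAB nAB c'q (colouring_fvs (colouring_leq bq db))).
  case: cB => [oB|[r bE' [d' d'r]]|[bE' _]]; [by constructor 1; apply: octB| |lia].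
  have rq : r <= q by lia.
  constructor 2; exists q => //; eexists.
  exact: (fvs_colouring_sum dAB nAB c'q (fvs_colouring_leq rq d'r)).
- have [B0|[w wB]] := set_0Vmem B; first by constructor 3; split=> //; exists v; rewrite B0 setU0.
  (* The vertex [v] and any [w] of [B] are non-adjacent and form the complement of a single
     [K_2]. *)
  constructor 1; rewrite aE; exists (fun _ t => if t == ord0 then v else w); split.
  + by move=> _ t; rewrite AE !inE; case: ifP; rewrite ?eqxx ?wB ?orbT.
  + have nvw : v != w by apply: contraTneq wB => <-; rewrite (disjointFr dAB) // AE set11.
    move=> _ [[|[|//]] p] [[|[|//]] p'] /= E; apply/val_inj => //=; move: nvw.
      by rewrite E eqxx.
    by rewrite E eqxx.
  + have vw : v -- w = false by apply: negPf; apply: nAB; rewrite // AE set11.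
    by move=> i j t u; rewrite !ord1 eqxx; do 2![case: ifP => _]; rewrite ?adj_irrefl // adj_sym.
Qed.

(** Clique numbers add. Unless both sides carry octahedra, a feedback vertex set or a single vertex
    on one side saves two colours in the join. *)
Lemma certified_join A B : B != set0 -> A != set0 -> {in A & B, forall x y, x -- y} ->
  certified A -> certified B -> certified (A :|: B).
Proof.
move=> B0 A0 jAB [a [Ka [c ca] cA]] [b [Kb [d db] cB]].
have jBA : {in B & A, forall x y, x -- y} by move=> x y xB yA; rewrite adj_sym jAB.
exists (a + b); split; first exact: clique_join.
  by eexists; apply: (colouring_join ca db).
have cone v C k f : C != set0 -> {in C, forall x, v -- x} -> colouring k C f ->
    exists2 q, k.+1 = q.+2 & exists g, fvs_colouring q (v |: C) g.
  (* Nonemptiness of [C] forces [k] to be positive, so [k.+1] has the form [q.+2]. *)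
  case/set0Pn=> x xC vC; case: k => [|q] fC; first by have := fC.1 x xC.
  by exists q => //; eexists; apply: (fvs_colouring_cone vC fC).
case: cA => [oA|[q aE [c' c'q]]|[aE [v AE]]].
- case: cB => [oB|[q bE [d' d'q]]|[bE [v BE]]].
  + by constructor 1; apply: octahedron_join.
  + constructor 2; exists (q + a); first by rewrite bE addnC.
    by rewrite setUC; eexists; apply: (fvs_colouring_join d'q ca).
  + constructor 2; rewrite BE setUC bE addn1; apply: cone ca => // x xA.
    by apply: jBA; rewrite // BE set11.
- constructor 2; exists (q + b); first by rewrite aE.
  by eexists; apply: (fvs_colouring_join c'q db).
- constructor 2; rewrite AE aE; apply: cone db => // x xB.
  by apply: jAB; rewrite // AE set11.
Qed.

Lemma P4_free_certified S : P4_free (@adj G) -> certified S.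
Proof.
move=> P4; apply: (P4_free_ind P4) S => [|x||].
- exists 0; split.
  + by exists set0; split; rewrite ?cards0 // => x y; rewrite inE.
  + by exists (fun=> 0); split=> [x|x y]; rewrite inE.
  + have f : 'I_0 -> 'I_2 -> G by case.
    by constructor 1; exists f; split=> -[].
- exists 1; split.
  + exists [set x]; split; rewrite ?cards1 // => y z; rewrite !inE => /eqP-> /eqP->.
    by rewrite eqxx.
  + exists (fun=> 0); split=> [//|y z]; rewrite !inE => /eqP-> /eqP->.
    by rewrite adj_irrefl.
  + by constructor 3; split=> //; exists x.
- exact: certified_sum.
- exact: certified_join.
Qed.

(** * Translation to and from induced subgraphs and feedback vertex sets *)

Lemma contains_inducedP (H : sgraph) : contains_induced G H <->
  exists2 f : H -> G, injective f & forall x y, f x -- f y = adj x y.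
Proof.
split=> [[S [f [g fK gK] fe]]|[f fi fe]].
  exists (fun x => val (g x)) => [x y /val_inj/(can_inj gK)//|x y].
  by rewrite -{2}(gK x) -{2}(gK y) fe.
have fS x : f x \in f @: [set: H] by rewrite imset_f.
pose h x : induced (f @: [set: H]) := exist _ (f x) (fS x).
have hi : injective h by move=> x y /(congr1 val)/fi.
have hc : #|induced (f @: [set: H])| <= #|H|.
  by rewrite card_sig (eq_card (B := mem (f @: [set: H]))) // card_imset ?cardsT.
have [g gK hK] := inj_card_bij hi hc.
exists (f @: [set: H]), g; first by exists h.
by move=> x y; rewrite -fe -[in RHS](hK x) -[in RHS](hK y).
Qed.

Lemma cograph_P4_free : cograph G -> P4_free (@adj G).
Proof.
move=> cG a b c d ab bc cd; apply/negPn/negP; rewrite !negb_or => /and3P[ac bd ad].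
case: cG; apply/contains_inducedP; exists (fun i : 'I_4 => nth a [:: a; b; c; d] i); last first.
  by move=> [[|[|[|[|//]]]] p] [[|[|[|[|//]]]] p'] /=;
    rewrite ?adj_irrefl ?ab ?bc ?cd ?(negPf ac) ?(negPf bd) ?(negPf ad) // adj_sym
      ?ab ?bc ?cd ?(negPf ac) ?(negPf bd) ?(negPf ad).
(* Vertices of the path are told apart by a third vertex adjacent to exactly one of them. *)
have nE x y z : x -- z -> ~~ y -- z -> (x == y) = false.
  by move=> xz yz; apply: contraNF yz => /eqP <-.
have U : uniq [:: a; b; c; d].
  rewrite /= !inE !negb_or !andbT.
  rewrite (nE a b b) ?(nE b c c) ?(nE c d d) ?adj_irrefl // (nE b d a) ?[_ -- a]adj_sym //.
  by rewrite (eq_sym a c) (nE c a d) // (eq_sym a d) (nE d a c) // adj_sym.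
by move=> i j /eqP; rewrite nth_uniq // => /eqP/val_inj.
Qed.

Lemma clique_contains k l : k <= l -> clique l [set: G] ->
  contains_induced G (complete_graph k).
Proof.
move=> kl [K [_ Kl Kc]]; rewrite -Kl in kl; apply/contains_inducedP.
have fi : injective (fun i : 'I_k => enum_val (widen_ord kl i)).
  by move=> i j /enum_val_inj/(congr1 val) /= /val_inj.
exists (fun i : 'I_k => enum_val (widen_ord kl i)) => // i j.
have [->|nij] := eqVneq i j; first by rewrite !adj_irrefl.
rewrite [RHS](_ : _ = true) ?Kc ?enum_valP //.
by apply: contra nij => /eqP/fi->.
Qed.

Lemma octahedronP k : octahedron k [set: G] <->
  contains_induced G (compl_graph (copies (complete_graph 2) k)).
Proof.
(* In the complement of disjoint edges, adjacency means lying in different copies. *)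
have adjE (u v : compl_graph (copies (complete_graph 2) k)) : adj u v = (u.1 != v.1).
  case: u v => [i b] [j d]; rewrite /adj /= /compl_adj /adj /= /copies_adj /adj /=.
  by rewrite xpair_eqE; case: eqVneq => //=; case: eqVneq.
split=> [[f [_ fi fe]]|/contains_inducedP[f fi fe]].
  apply/contains_inducedP; exists (fun u => f u.1 u.2); last by move=> u v; rewrite fe adjE.
  move=> [i b] [j d] /= E; have := fe i j b d; rewrite E adj_irrefl.
  by case: eqVneq => // ij _; move: E; rewrite ij => /fi->.
exists (fun i b => f (i, b)); split=> [i b|i b d /fi[]|i j b d]; rewrite ?inE //.
by rewrite fe adjE.
Qed.

Lemma fvs_colouring_has q c : fvs_colouring q [set: G] c -> has_colourable_fvs q G.
Proof.
case=> ck cp ca; exists [set x | c x == 0], (fun i => [set x | c x == i.+1]); split.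
- apply/setP => x; rewrite !inE; have [//|cx /=] := eqVneq (c x) 0.
  have xq : (c x).-1 < q by have := ck x (in_setT x); lia.
  by apply/bigcupP; exists (Ordinal xq) => //; rewrite inE /=; lia.
- by move=> i; rewrite disjoints_subset; apply/subsetP => x; rewrite !inE => /eqP->.
- move=> i j ij; rewrite disjoints_subset; apply/subsetP => x; rewrite !inE => /eqP->.
  by rewrite eqSS.
- move=> s s2 /andP[cyc us]; apply: (ca (map val s)); first by rewrite size_map.
    by move=> _ /mapP[x _ ->]; have := valP x; rewrite !inE.
  rewrite /ucycle (map_inj_uniq val_inj) us andbT.
  case: s cyc {s2 us} => // x s; rewrite /cycle map_cons -map_rcons path_map.
  by [].
- move=> i x y; rewrite !inE => /eqP cx /eqP cy; apply/negP => xy.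
  by have := cp x y (in_setT _) (in_setT _) xy; rewrite cx cy => /(_ erefl).
Qed.

(** * The two obstructions to a feedback vertex set *)

(** An independent set meets a clique in at most one vertex and an octahedron in at most one pair.
    With [q] such sets, at least [n - q] vertices, or whole pairs, remain in the forest. *)
Lemma card_uncovered n q (U : {set 'I_n}) (J : 'I_q -> {set 'I_n}) :
  (forall x, x \notin U -> exists i, x \in J i) -> (forall i, #|J i| <= 1) ->
  n - q <= #|U|.
Proof.
move=> cov J1; have := cardsC U; rewrite card_ord.
have : #|~: U| <= #|\bigcup_i J i|.
  apply/subset_leq_card/subsetP => x; rewrite inE => /cov[i xi].
  by apply/bigcupP; exists i.
have : #|\bigcup_i J i| <= \sum_(i < q) 1.
  elim/big_ind2: _ => [|A a B b Aa Bb|i _]; rewrite ?cards0 //.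
  exact: leq_trans (leq_card_setU _ _) (leq_add Aa Bb).
rewrite sum1_card card_ord; lia.
Qed.

Lemma has_fvs_no_clique q : has_colourable_fvs q G -> free G (complete_graph (q + 3)).
Proof.
case=> F [I [cov _ _ Ff Ii]] /contains_inducedP[f fi fe].
have : q + 3 - q <= #|[set i | f i \in F]|.
  apply: (@card_uncovered _ _ _ (fun i => [set j | f j \in I i])).
    move=> j; rewrite inE => jF; have := in_setT (f j); rewrite -cov inE (negPf jF) /=.
    by case/bigcupP=> i _ ji; exists i; rewrite inE.
  move=> i; rewrite leqNgt; apply/card_gt1P => -[j [k []]]; rewrite !inE => ji ki jk.
  by have := Ii i _ _ ji ki; rewrite fe /= jk.
(* Three clique vertices left in [F] form a triangle. *)
rewrite addKn => /card_gt2P[i [j [k [[]]]]]; rewrite !inE => iF jF kF [ij jk ki].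
pose u : induced F := exist _ (f i) iF; pose v : induced F := exist _ (f j) jF.
pose w : induced F := exist _ (f k) kF.
apply: (Ff [:: u; v; w]) => //.
rewrite /ucycle /= !inE -!val_eqE /= !(inj_eq fi) /adj /= /induced_adj /= !fe /=.
by rewrite (eq_sym i k) (negPf ij) (negPf jk) (negPf ki).
Qed.

Lemma has_fvs_no_octahedron q : has_colourable_fvs q G ->
  free G (compl_graph (copies (complete_graph 2) (q + 2))).
Proof.
case=> F [I [cov _ _ Ff Ii]] /octahedronP[f [_ fi fe]].
have : q + 2 - q <= #|[set i | [forall b, f i b \in F]]|.
  apply: (@card_uncovered _ _ _ (fun i => [set j | [exists b, f j b \in I i]])).
    move=> j; rewrite inE negb_forall => /existsP[b jF].
    have := in_setT (f j b); rewrite -cov inE (negPf jF) /=.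
    by case/bigcupP=> i _ ji; exists i; rewrite inE; apply/existsP; exists b.
  move=> i; rewrite leqNgt; apply/card_gt1P => -[j [k []]].
  rewrite !inE => /existsP[b ji] /existsP[d ki] jk.
  by have := Ii i _ _ ji ki; rewrite fe jk.
rewrite addKn => /card_gt1P[i [j []]]; rewrite !inE => /forallP iF /forallP jF ij.
have ne k b d : f k b == f k d = (b == d) by apply: inj_eq.
have ne' b d : f i b == f j d = false.
  by apply/eqP => E; have := fe i j b d; rewrite E adj_irrefl ij.
pose u b : induced F := exist _ (f i b) (iF b); pose v b : induced F := exist _ (f j b) (jF b).
(* Two whole pairs left in [F] give a four-cycle alternating between them. *)
apply: (Ff [:: u ord0; v ord0; u ord_max; v ord_max]) => //.
rewrite /ucycle /= !inE -!val_eqE /= !ne !(eq_sym (f j _)) !ne' /adj /= /induced_adj /= !fe.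
by rewrite (eq_sym j i) !ij.
Qed.

End Cographs.

(** * Combining certificates and obstructions *)

Theorem theorem4 (q : nat) (G : sgraph) (hG : cograph G) :
  has_colourable_fvs q G <->
  free G (complete_graph (q + 3)) /\
  free G (compl_graph (copies (complete_graph 2) (q + 2))).
Proof.
split=> [fvs|[nK nO]].
  by split; [apply: has_fvs_no_clique | apply: has_fvs_no_octahedron].
have [k [Kk [c ck] alt]] := P4_free_certified [set: G] (cograph_P4_free hG).
have [kq|kq] := leqP k q.+1.
  exact: fvs_colouring_has (colouring_fvs (colouring_leq kq ck)).
have [lk|kl] := leqP (q + 3) k; first by case: nK; apply: clique_contains Kk.
have kE : k = q + 2 by lia.
(* The octahedron is forbidden and [k = 1] contradicts [k = q + 2]. *)
case: alt => [oG|[r rE [d dr]]|[k1 _]]; last by lia.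
  by case: nO; apply/octahedronP; rewrite -kE.
have rq : r = q by lia.
by rewrite rq in dr; apply: fvs_colouring_has dr.
Qed.
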